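(* Let $k$ be an algebraically closed field, let $X$ be a variety over $k$, and let $f: X\dashrightarrow X$ be a dominant rational self-map. Let $x\in X(k)$ be a point whose $f$-orbit is well defined and such that $O_f(x)$ is Zariski dense in $X$. Let $V$ be a proper subvariety of $X$. Then $\{n\geq 0\mid f^n(x)\in V\}$ is of Banach density zero in $\mathbb{Z}_{\geq 0}$, i.e. for every sequence of (finite, nonempty) intervals $I_n$, $n\geq 0$, in $\mathbb{Z}_{\geq 0}$ with $\lim_{n\to\infty}\# I_n=+\infty$, we have $$\lim_{n\to\infty}\frac{\#(\{m\geq 0\mid f^m(x)\in V\}\cap I_n)}{\#I_n}=0.$$
   Context: A variety is an irreducible, reduced, separated scheme of finite type over a field; a subvariety of $X$ is a Zariski closed subset of $X$. The $f$-orbit of $x$ is well defined if $f^n(x)$ is not in the indeterminacy locus of $f$ for all $n\ge 0$; then $O_f(x)=\{f^n(x)\mid n\ge0\}$. *)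

(* Defs.v *)
From HB Require Import structures.
From mathcomp Require Import all_boot all_order all_algebra.
From mathcomp Require Import finmap.
From mathcomp Require Import all_classical all_reals.
From mathcomp Require Import topology normedtype sequences.

Set Implicit Arguments.
Unset Strict Implicit.
Unset Printing Implicit Defensive.

Import Order.TTheory GRing.Theory Num.Theory.
Import numFieldNormedType.Exports.

Local Open Scope classical_set_scope.
Local Open Scope ring_scope.

Record opens (X : topologicalType) := Opens {
  oset :> set X;
  oset_open : open oset }.

Definition fullO (X : topologicalType) : opens X := Opens openT.

(* Sections over the empty set form the zero ring, so rings of sections are
   [comPzRingType]s.  The algebra structures of MathComp require [1 != 0]; a
   k-algebra is therefore given here by its structure morphism [const] from k. *)
Record ringedSpace (k : fieldType) := RingedSpace {
  rs_top :> topologicalType;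
  sections : opens rs_top -> comPzRingType;
  const : forall U, {rmorphism k -> sections U};
  res : forall U V : opens rs_top, V `<=` U ->
    {rmorphism sections U -> sections V};
  res_id : forall (U : opens rs_top) (h : U `<=` U) s, res h s = s;
  res_res : forall (U V W : opens rs_top)
    (hV : V `<=` U) (hW : W `<=` V) (hWU : W `<=` U) s,
    res hW (res hV s) = res hWU s;
  res_const : forall (U V : opens rs_top) (h : V `<=` U) c,
    res h (const U c) = const V c;
  glue : forall (I : Type) (U : opens rs_top) (V : I -> opens rs_top)
    (hV : forall i, V i `<=` U) (s : forall i, sections (V i)),
    U `<=` \bigcup_i V i ->
    (forall i j (W : opens rs_top) (hi : W `<=` V i) (hj : W `<=` V j),
       res hi (s i) = res hj (s j)) ->
    exists! t : sections U, forall i, res (hV i) t = s i }.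

Arguments const {k r}.
Arguments res {k r U V}.

Definition invertible (A : comPzRingType) (a : A) : Prop :=
  exists b, a * b = 1.

Definition prime_ideal (A : comPzRingType) (P : set A) : Prop :=
  [/\ P 0 /\ ~ P 1,
      forall a b, P a -> P b -> P (a + b),
      forall a b, P b -> P (a * b) &
      forall a b, P (a * b) -> P a \/ P b].

(* The germ of [s] at [x] is a unit of the stalk; this entails [U x]. *)
Definition unit_at (k : fieldType) (X : ringedSpace k) (U : opens X)
    (s : sections U) (x : X) : Prop :=
  exists (W : opens X) (h : W `<=` U), oset W x /\ invertible (res h s).

(* The canonical map from U to Spec A, A = O(U), sending x to the prime of the
   sections whose germ at x is not a unit, is an isomorphism: it is bijective,
   the preimages U_s of the principal opens D(s) form a basis of the topology
   of U, and O(U) -> O(U_s) is the localization of A at s. *)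
Definition affine (k : fieldType) (X : ringedSpace k) (U : opens X) : Prop :=
  [/\ forall P : set (sections U), prime_ideal P <->
        exists2 x, oset U x & P = [set s | ~ unit_at s x],
      forall x y, oset U x -> oset U y ->
        (forall s : sections U, unit_at s x <-> unit_at s y) -> x = y,
      forall (W : opens X) x, W `<=` U -> oset W x ->
        exists2 s : sections U, unit_at s x & unit_at s `<=` W &
      forall (s : sections U) (D : opens X) (h : D `<=` U),
        (D : set X) = unit_at s ->
        [/\ invertible (res h s),
            forall t : sections D, exists n a, t * res h s ^+ n = res h a &
            forall a, res h a = 0 -> exists n, s ^+ n * a = 0]].

(* Schemes over k.  Stalks are local rings because they are so on affine
   opens. *)
Record scheme (k : fieldType) := Scheme {
  sch_rs :> ringedSpace k;
  sch_affine : forall x : sch_rs, exists2 U : opens sch_rs, oset U x & affine U }.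

(* Morphisms over k from the open subscheme U of X to Y.  The values of [mfun]
   outside U are irrelevant.  [pull V W] is the map O_Y(V) -> O_X(f^-1 V)
   followed by restriction to W. *)
Record morphism (k : fieldType) (X Y : scheme k) (U : opens X) := Morphism {
  mfun :> X -> Y;
  mfun_cont : forall V, open V -> open (U `&` mfun @^-1` V);
  pull : forall (V : opens Y) (W : opens X), W `<=` U `&` mfun @^-1` V ->
    {rmorphism sections V -> sections W};
  pull_res : forall (V V' : opens Y) (W W' : opens X)
    (h : W `<=` U `&` mfun @^-1` V) (h' : W' `<=` U `&` mfun @^-1` V')
    (hV : V' `<=` V) (hW : W' `<=` W) s,
    res hW (pull h s) = pull h' (res hV s);
  pull_const : forall (V : opens Y) (W : opens X)
    (h : W `<=` U `&` mfun @^-1` V) c, pull h (const V c) = const W c;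
  pull_local : forall (V : opens Y) (W : opens X)
    (h : W `<=` U `&` mfun @^-1` V) s x,
    oset W x -> unit_at (pull h s) x -> unit_at s (mfun x) }.

Arguments pull {k X Y U} m {V W}.

(* The restrictions of f and g to the open subscheme W are the same morphism. *)
Definition agree_on (k : fieldType) (X Y : scheme k) (U U' : opens X)
    (f : morphism Y U) (g : morphism Y U') (W : opens X) : Prop :=
  [/\ W `<=` U `&` U',
      forall x, oset W x -> f x = g x &
      forall (V : opens Y) (W' : opens X) (h : W' `<=` U `&` f @^-1` V)
        (h' : W' `<=` U' `&` g @^-1` V) s,
        W' `<=` W -> pull f h s = pull g h' s].

(* g o f = h on U *)
Definition is_comp (k : fieldType) (X Y Z : scheme k) (U : opens X)
    (g : morphism Z (fullO Y)) (f : morphism Y U) (h : morphism Z U) : Prop :=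
  (forall x, oset U x -> g (f x) = h x) /\
  forall (V : opens Z) (V' : opens Y) (W : opens X)
    (hg : V' `<=` fullO Y `&` g @^-1` V) (hf : W `<=` U `&` f @^-1` V')
    (hh : W `<=` U `&` h @^-1` V) s,
    pull f hf (pull g hg s) = pull h hh s.

Definition is_id (k : fieldType) (X : scheme k) (f : morphism X (fullO X)) :
    Prop :=
  (forall x, f x = x) /\
  forall (V W : opens X) (h : W `<=` fullO X `&` f @^-1` V) (h' : W `<=` V) s,
    pull f h s = res h' s.

Definition is_product (k : fieldType) (X Y P : scheme k)
    (p : morphism X (fullO P)) (q : morphism Y (fullO P)) : Prop :=
  forall (T : scheme k) (U : opens T) (a : morphism X U) (b : morphism Y U),
    (exists c : morphism P U, is_comp p c a /\ is_comp q c b) /\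
    forall c c' : morphism P U,
      is_comp p c a -> is_comp q c b -> is_comp p c' a -> is_comp q c' b ->
      agree_on c c' U.

(* Homeomorphism onto a closed subset, surjective on stalks. *)
Definition closed_immersion (k : fieldType) (X Y : scheme k)
    (d : morphism Y (fullO X)) : Prop :=
  [/\ closed (range d),
      injective d,
      forall U : opens X, exists V : opens Y, (U : set X) = d @^-1` V &
      forall (U : opens X) (s : sections U) x, oset U x ->
        exists (V : opens Y) (W : opens X) (hW : W `<=` U)
          (h : W `<=` fullO X `&` d @^-1` V) (t : sections V),
          oset W x /\ pull d h t = res hW s].

Definition separated_scheme (k : fieldType) (X : scheme k) : Prop :=
  exists (P : scheme k) (p q : morphism X (fullO P))
    (id : morphism X (fullO X)) (d : morphism P (fullO X)),
    [/\ is_product p q, is_id id, is_comp p d id, is_comp q d id &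
        closed_immersion d].

Definition irreducible (X : topologicalType) : Prop :=
  [set: X] !=set0 /\
  forall A B : set X, closed A -> closed B -> A `|` B = setT ->
    A = setT \/ B = setT.

Definition reduced (k : fieldType) (X : scheme k) : Prop :=
  forall (U : opens X) (s : sections U) n, s ^+ n = 0 -> s = 0.

Definition finitely_generated (k : fieldType) (X : scheme k) (U : opens X) :
    Prop :=
  exists (n : nat) (a : 'I_n -> sections U),
    forall S : {pred sections U}, GRing.subring_closed S ->
      (forall c, const U c \in S) -> (forall i, a i \in S) ->
      forall s, s \in S.

Definition finite_type (k : fieldType) (X : scheme k) : Prop :=
  exists (m : nat) (U : 'I_m -> opens X),
    (forall x, exists i, oset (U i) x) /\
    forall i, affine (U i) /\ finitely_generated (U i).

Record variety (k : fieldType) := Variety {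
  var_scheme :> scheme k;
  var_irreducible : irreducible var_scheme;
  var_reduced : reduced var_scheme;
  var_separated : separated_scheme var_scheme;
  var_finite_type : finite_type var_scheme }.

(* The residue field at x is k; such points correspond to the elements of
   X(k). *)
Definition rational_point (k : fieldType) (X : scheme k) (x : X) : Prop :=
  forall (U : opens X) (s : sections U), oset U x ->
    exists c : k, ~ unit_at (s - const U c) x.

Record partial_map (k : fieldType) (X Y : scheme k) := PartialMap {
  pdom : opens X;
  pdom_dense : dense pdom;
  pmor :> morphism Y pdom }.

Definition equiv_partial (k : fieldType) (X Y : scheme k)
    (f g : partial_map X Y) : Prop :=
  exists2 W : opens X, dense W & agree_on f g W.

(* Rational maps as equivalence classes of partial maps. *)
Record rational_map (k : fieldType) (X Y : scheme k) := RationalMap {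
  representatives : set (partial_map X Y);
  representativesP : exists f, representatives = [set g | equiv_partial f g] }.

Section RationalMaps.
Context (k : fieldType) (X Y : scheme k) (f : rational_map X Y).

(* f is defined at x, with value y *)
Definition maps_to (x : X) (y : Y) : Prop :=
  exists2 g, representatives f g & oset (pdom g) x /\ g x = y.

Definition indeterminacy : set X := [set x | ~ exists y, maps_to x y].

Definition dominant : Prop := dense [set y | exists x, maps_to x y].

End RationalMaps.

Section SelfMaps.
Context (k : fieldType) (X : scheme k) (f : rational_map X X).

(* f(x), and a junk value when x is in the indeterminacy locus *)
Definition rat_app (x : X) : X := xget x (maps_to f x).

Definition orbit_well_defined (x : X) : Prop :=
  forall n, ~ indeterminacy f (iter n rat_app x).

Definition forward_orbit (x : X) : set X :=
  [set iter n rat_app x | n in [set: nat]].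

End SelfMaps.

Definition nat_interval (I : set nat) : Prop :=
  exists a b : nat, (a <= b)%N /\ I = [set m | (a <= m <= b)%N].

(* Meant for finite sets. *)
Definition cardinal (A : set nat) : nat := #|` fset_set A|%fset.

Definition banach_density_zero (R : realType) (S : set nat) : Prop :=
  forall I : nat -> set nat, (forall n, nat_interval (I n)) ->
    cardinal (I n) @[n --> \oo] --> \oo ->
    ((cardinal (S `&` I n))%:R / (cardinal (I n))%:R : R) @[n --> \oo] --> (0 : R).

(* Main.v *)
Require Import Defs.
From mathcomp Require Import all_boot all_order all_algebra.
From mathcomp Require Import finmap zify.
From mathcomp Require Import all_classical all_reals.
From mathcomp Require Import topology normedtype.

Set Implicit Arguments.
Unset Strict Implicit.
Unset Printing Implicit Defensive.

Import Order.TTheory GRing.Theory Num.Theory.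
Import numFieldNormedType.Exports.

Local Open Scope classical_set_scope.
Local Open Scope ring_scope.

(* Rational maps to a separated scheme are single-valued, and a scheme of
   finite type is a noetherian topological space.  Suppose that the times at
   which the orbit visits V do not have Banach density zero, and choose Z
   minimal among the closed subsets of V with this property.  By Poincare
   recurrence for sets of integers there is d > 0 such that the times n with
   both f^n(x) and f^(n+d)(x) in Z still do not have density zero; by
   minimality these f^n(x) are dense in Z, so f^d maps Z to itself where it is
   defined.  Hence the orbit visits Z along a whole progression n0 + d N.  As X
   is irreducible, one of the d progressions n0 + i + d N gives a dense part of
   the orbit; applying the dominant map f^(d-i), V is dense in X. *)

(** * Rational maps to a separated scheme *)

Section Morphisms.
Context {k : fieldType}.

Section Restriction.
Context (X Y : scheme k) (U U' : opens X) (g : morphism Y U) (UU' : U' `<=` U).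

Fact restrict_cont V : open V -> open (U' `&` g @^-1` V).
Proof.
move=> oV; have -> : U' `&` g @^-1` V = U' `&` (U `&` g @^-1` V).
  by rewrite setIA (setIidl UU').
by apply: openI; [exact: oset_open | exact: mfun_cont].
Qed.

Fact restrict_sub (V : opens Y) (W : opens X) :
  W `<=` U' `&` g @^-1` V -> W `<=` U `&` g @^-1` V.
Proof. by move=> h x /h[/UU']. Qed.

Definition restrict : morphism Y U'.
Proof.
refine (@Morphism k X Y U' g restrict_cont
  (fun V W h => pull g (restrict_sub h)) _ _ _).
- by move=> V V' W W' h h' hV hW s; exact: pull_res.
- by move=> V W h c; exact: pull_const.
- by move=> V W h s x; exact: pull_local.
Defined.

End Restriction.

Section Composition.
Context (X Y Z : scheme k) (U : opens X).
Context (d : morphism Z (fullO Y)) (g : morphism Y U).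

Fact preimage_open (V : opens Z) : open (d @^-1` V).
Proof.
by have := mfun_cont d (oset_open V); rewrite setTI.
Qed.

Let pre (V : opens Z) : opens Y := Opens (preimage_open V).

Fact comp_cont V : open V -> open (U `&` (d \o g) @^-1` V).
Proof. by move=> oV; exact: (mfun_cont g (oset_open (pre (Opens oV)))). Qed.

Fact pre_sub V : pre V `<=` fullO Y `&` d @^-1` V.
Proof. by rewrite setTI. Qed.

Fact comp_sub (V : opens Z) (W : opens X) :
  W `<=` U `&` (d \o g) @^-1` V -> W `<=` U `&` g @^-1` pre V.
Proof. by []. Qed.

Definition comp_morphism : morphism Z U.
Proof.
refine (@Morphism k X Z U (d \o g) comp_cont
  (fun V W h => (pull g (comp_sub h) \o pull d (@pre_sub V))%FUN) _ _ _) => /=.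
- move=> V V' W W' h h' hV hW s.
  have hp : pre V' `<=` pre V by move=> y; apply: hV.
  by rewrite (pull_res (comp_sub h) (comp_sub h') hp hW)
    (pull_res (@pre_sub V) (@pre_sub V') hV hp).
- by move=> V W h c; rewrite !pull_const.
- by move=> V W h s x Wx /(pull_local Wx) /pull_local; apply; case: (h _ Wx).
Defined.

End Composition.

Lemma agree_on_sub (X Y : scheme k) (U U' : opens X) (f : morphism Y U)
    (g : morphism Y U') (W W' : opens X) :
  W' `<=` W -> agree_on f g W -> agree_on f g W'.
Proof.
move=> sW [h1 h2 h3]; split=> [x /sW/h1//|x /sW/h2//|V W0 h h' s W0W'].
by apply: h3 => x /W0W'/sW.
Qed.

Lemma agree_on_join (X Y : scheme k) (U0 U U' : opens X) (f : morphism Y U0)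
    (g : morphism Y U) (g' : morphism Y U') (W : opens X) :
  agree_on f g W -> agree_on f g' W -> agree_on g g' W.
Proof.
move=> [h1 h2 h3] [h1' h2' h3']; split=> [x Wx|x Wx|V W' h h' s W'W].
- by split; [have [] := h1 x Wx | have [] := h1' x Wx].
- by rewrite -h2 // h2'.
- have hf : W' `<=` U0 `&` f @^-1` V.
    move=> x W'x; have Wx := W'W x W'x; split; first by have [] := h1 x Wx.
    by rewrite /preimage /= h2 //; have [] := h x W'x.
  by rewrite -(h3 _ _ hf) // -(h3' _ _ hf).
Qed.

Lemma denseI_open (T : topologicalType) (A B : set T) :
  open A -> dense A -> dense B -> dense (A `&` B).
Proof.
move=> oA dA dB N N0 oN; rewrite setIA.
by apply: dB; [exact: dA | exact: openI].
Qed.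

(** Used once for each projection of the product: the diagonal after [g] has first component [g] and
    second component [g'] on [W], so it solves the same universal problem as the pair of [g] and
    [g']. *)
Lemma graph_is_comp (X P : scheme k) (W : opens X) (p : morphism X (fullO P))
    (d : morphism P (fullO X)) (id : morphism X (fullO X))
    (U U' : opens X) (g : morphism X U) (g' : morphism X U')
    (WU : W `<=` U) (WU' : W `<=` U') :
  is_id id -> is_comp p d id -> agree_on g g' W ->
  is_comp p (comp_morphism d (restrict g WU)) (restrict g' WU').
Proof.
move=> [id1 id2] [pd1 pd2] [_ gg1 gg2]; split=> [x Wx|V V' W' hg hf hh s] /=.
  by rewrite pd1 // id1 gg1.
(* [V0] is the preimage of [V'] under [d]. As [p] after [d] is the identity, it lies in [V], and
   pulling back along [p] and then [d] is restriction from [V] to [V0]. *)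
set V0 := Opens _; set hd := (X in pull d X).
have V0V : V0 `<=` V.
  by move=> y /hg[_]; rewrite /preimage /= pd1 // id1.
have hid : V0 `<=` fullO X `&` id @^-1` V.
  by move=> y /V0V Vy; split=> //; rewrite /preimage /= id1.
rewrite (pd2 _ _ _ hg hd hid) (id2 _ _ hid V0V).
set h1 := (X in pull g X); set h2 := (X in pull g' X).
have h1' : W' `<=` U `&` g @^-1` V by move=> x /h1[Ux /V0V].
have W'W' : W' `<=` W' by [].
rewrite -(pull_res h1' h1 V0V W'W') res_id.
by apply: gg2 => x /hf[].
Qed.

Lemma restrict_is_comp (X Y Z : scheme k) (W T U : opens X)
    (e : morphism Z (fullO Y)) (b : morphism Y T) (a : morphism Z U)
    (WT : W `<=` T) (WU : W `<=` U) (TU : T `<=` U) :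
  is_comp e b (restrict a TU) -> is_comp e (restrict b WT) (restrict a WU).
Proof.
move=> [e1 e2]; split=> [y /WT/e1//|V V' W' hg hf hh s] /=.
have hh' : W' `<=` T `&` restrict a TU @^-1` V.
  by move=> y W'y; split; [have [/WT] := hf _ W'y | have [] := hh _ W'y].
by rewrite (e2 _ _ _ _ _ hh') /=; congr (pull a _ s); exact: Prop_irrelevance.
Qed.

(* Two morphisms to a separated scheme which agree on a dense open set W
   factor, on W, through the diagonal; the diagonal being closed, the morphism
   to the product that they define takes all its values in it. *)
Lemma separated_agree (X : scheme k) (U U' W : opens X)
    (g : morphism X U) (g' : morphism X U') :
  separated_scheme X -> dense W -> agree_on g g' W ->
  forall x, oset U x -> oset U' x -> g x = g' x.
Proof.
move=> [P [p [q [id [d [prodP idP pd qd [cd _ _ _]]]]]]] dW gg' x Ux U'x.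
pose T : opens X := Opens (openI (oset_open U) (oset_open U')).
have TU : T `<=` U by move=> y [].
have TU' : T `<=` U' by move=> y [].
have WT : W `<=` T by case: gg'.
have WU : W `<=` U by move=> y /WT[].
have WU' : W `<=` U' by move=> y /WT[].
have [[c [pc qc]] _] := prodP X T (restrict g TU) (restrict g' TU').
have gg : agree_on g g W.
  split=> [y /WU//|//|V W' h h' s _].
  by congr (pull g _ s); exact: Prop_irrelevance.
have [_ uniq] := prodP X W (restrict g WU) (restrict g' WU').
have [_ cE _] := uniq (restrict c WT) (comp_morphism d (restrict g WU))
  (restrict_is_comp WT WU pc) (restrict_is_comp WT WU' qc)
  (graph_is_comp WU WU idP pd gg) (graph_is_comp WU WU' idP qd gg').
have [y _ dy] : range d (c x).
  apply: contrapT => Ncx.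
  have oN := mfun_cont c (closed_openC cd).
  have [|z [[_ Nz] Wz]] := dW _ _ oN; first by exists x.
  by apply: Nz; exists (g z) => //; rewrite -/((restrict c WT) z) cE.
have -> : g x = p (c x) by case: pc => ->.
have -> : g' x = q (c x) by case: qc => ->.
by case: pd => pd _; case: qd => qd _; rewrite -dy pd // qd.
Qed.

Section RationalSelfMap.
Context (X : scheme k) (f : rational_map X X) (sepX : separated_scheme X).

(** Two representatives agree with a common one on dense open sets, hence with each other on the
    intersection, which is still dense; separatedness carries this to every common point of
    definition. *)
Lemma maps_to_unique x y y' : maps_to f x y -> maps_to f x y' -> y = y'.
Proof.
move=> [g fg [gx <-]] [g' fg' [gx' <-]].
have [f0 rf] := representativesP f.
move: fg fg'; rewrite rf => -[W1 d1 a1] [W2 d2 a2].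
pose W : opens X := Opens (openI (oset_open W1) (oset_open W2)).
apply: (@separated_agree _ _ _ W) gx gx' => //.
  exact: denseI_open (oset_open W1) d1 d2.
by apply: agree_on_join (agree_on_sub _ a1) (agree_on_sub _ a2) => x' [].
Qed.

Lemma rat_appE x y : maps_to f x y -> rat_app f x = y.
Proof. by move=> xy; apply: maps_to_unique (xy); apply: xgetPex; exists y. Qed.

(** A representative defined at [x] is defined on a neighbourhood and, values being unique, computes
    [rat_app f] there. *)
Lemma rat_app_cont x (N : set X) : ~ indeterminacy f x ->
  open N -> N (rat_app f x) ->
  exists M, [/\ open M, M x & forall z, M z ->
    ~ indeterminacy f z /\ N (rat_app f z)].
Proof.
move=> /contrapT[y xy] oN; rewrite (rat_appE xy) => Ny.
case: xy => g fg [gx gxy]; exists (pdom g `&` g @^-1` N); split.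
- exact: mfun_cont.
- by split=> //; rewrite /preimage /= gxy.
- move=> z [gz Nz]; have zgz : maps_to f z (g z) by exists g.
  by split; [apply; exists (g z) | rewrite (rat_appE zgz)].
Qed.

Lemma iter_rat_app_cont d x (N : set X) :
  (forall i, ~ indeterminacy f (iter i (rat_app f) x)) ->
  open N -> N (iter d (rat_app f) x) ->
  exists M, [/\ open M, M x & forall z, M z -> N (iter d (rat_app f) z)].
Proof.
move=> orb; elim: d N => [|d IH] N oN /=; first by exists N.
move=> /(rat_app_cont (orb d) oN)[M [oM Mx MN]].
have [M' [oM' M'x M'M]] := IH M oM Mx.
by exists M'; split=> // z /M'M /MN[].
Qed.

(** Dominance gives a point sent into the open set [N], continuity a neighbourhood sent into [N],
    and [A] meets that neighbourhood. *)
Lemma dense_image_rat_app (A : set X) : dominant f ->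
  (forall a, A a -> ~ indeterminacy f a) -> dense A ->
  dense (rat_app f @` A).
Proof.
move=> domf Adom dA N N0 oN.
have [y [Ny [x xy]]] := domf _ N0 oN.
have xdom : ~ indeterminacy f x by apply; exists y.
have Nx : N (rat_app f x) by rewrite (rat_appE xy).
have [M [oM Mx MN]] := rat_app_cont xdom oN Nx.
have [|a [Ma Aa]] := dA M _ oM; first by exists x.
by exists (rat_app f a); split; [case: (MN a Ma) | exists a].
Qed.

End RationalSelfMap.
End Morphisms.

(** * Noetherianity *)

Lemma nondecreasing_sub (T : Type) (I : nat -> set T) :
  (forall n, I n `<=` I n.+1) -> forall m n, (m <= n)%N -> I m `<=` I n.
Proof.
move=> incI m n /subnK <-; elim: (n - m)%N => [//|i IH] a /IH.
exact: incI.
Qed.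

(** * Hilbert's basis theorem *)

Section HilbertBasis.
Context {A : comPzRingType}.
Implicit Types (B I J : set A) (x : A).

(** Subrings and their ideals are subsets of one ambient ring, so that generators can be adjoined
    one by one without polynomial rings or quotients. *)
Definition subring B : Prop :=
  [/\ B 1, forall a b, B a -> B b -> B (a - b) &
      forall a b, B a -> B b -> B (a * b)].

Definition ideal_of B I : Prop :=
  [/\ I `<=` B, I 0, forall a b, I a -> I b -> I (a + b) &
      forall a b, B a -> I b -> I (a * b)].

Definition noetherian B : Prop :=
  forall I : nat -> set A, (forall n, ideal_of B (I n)) ->
    (forall n, I n `<=` I n.+1) ->
    exists N, forall n, (N <= n)%N -> I n `<=` I N.

Lemma subring0 B : subring B -> B 0.
Proof. by move=> [B1 BB _]; rewrite -(subrr 1); exact: BB. Qed.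

Lemma subringN B a : subring B -> B a -> B (- a).
Proof. move=> sB Ba; rewrite -sub0r; case: (sB) => _ BB _.
by apply: BB => //; exact: subring0. Qed.

Lemma subringD B a b : subring B -> B a -> B b -> B (a + b).
Proof.
move=> sB Ba /(subringN sB) Bb; rewrite -[b]opprK.
by case: sB => _ BB _; exact: BB.
Qed.

(* Values at x of the polynomials of degree < m with coefficients in B. *)
Fixpoint span_below B x (m : nat) : set A :=
  if m is m'.+1 then
    [set a | exists b c, [/\ B b, span_below B x m' c & a = b * x ^+ m' + c]]
  else [set 0].

Definition adjoin B x : set A := [set a | exists m, span_below B x m a].

(** Possible coefficients of [x ^+ m] in elements of [I] written with degree at most [m]. As [x] may
    be algebraic over [B], one element can have several such expressions. *)
Definition lead_coefs B x m I : set A :=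
  [set b | B b /\ exists2 c, span_below B x m c & I (b * x ^+ m + c)].

Section Adjoin.
Context (B : set A) (x : A) (sB : subring B).

Lemma span_below0 m : span_below B x m 0.
Proof.
elim: m => [//|m IH]; exists 0, 0; split=> //; first exact: subring0.
by rewrite mul0r addr0.
Qed.

Lemma span_belowS m : span_below B x m `<=` span_below B x m.+1.
Proof.
move=> a Pa; exists 0, a; split=> //; first exact: subring0.
by rewrite mul0r add0r.
Qed.

Lemma span_belowW m n : (m <= n)%N -> span_below B x m `<=` span_below B x n.
Proof. exact: nondecreasing_sub span_belowS m n. Qed.

Lemma span_belowB m a b :
  span_below B x m a -> span_below B x m b -> span_below B x m (a - b).
Proof.
elim: m a b => [|m IH] a b /=; first by move=> -> ->; rewrite subrr.
move=> [a1 [a2 [Ba Pa ->]]] [b1 [b2 [Bb Pb ->]]].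
exists (a1 - b1), (a2 - b2); split; [by case: sB => _ + _; apply|exact: IH|].
by rewrite mulrBl opprD addrACA.
Qed.

Lemma span_belowD m a b :
  span_below B x m a -> span_below B x m b -> span_below B x m (a + b).
Proof.
move=> Pa Pb; rewrite -[b]opprK; apply: span_belowB => //.
by rewrite -sub0r; apply: span_belowB => //; exact: span_below0.
Qed.

Lemma span_belowM m a b :
  B a -> span_below B x m b -> span_below B x m (a * b).
Proof.
move=> Ba; elim: m b => [|m IH] b /=; first by move=> ->; rewrite mulr0.
move=> [b1 [b2 [Bb Pb ->]]]; exists (a * b1), (a * b2); split.
- by case: sB => _ _; apply.
- exact: IH.
- by rewrite mulrDr mulrA.
Qed.

Lemma span_belowX m b : span_below B x m b -> span_below B x m.+1 (x * b).
Proof.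
elim: m b => [|m IH] b; first by move=> ->; rewrite mulr0; exact: span_below0.
move=> [b1 [b2 [Bb /IH Pb ->]]]; exists b1, (x * b2); split=> //.
by rewrite mulrDr mulrCA -exprS.
Qed.

Lemma adjoin_base : B `<=` adjoin B x.
Proof. by move=> b Bb; exists 1, b, 0; split=> //; rewrite mulr1 addr0. Qed.

Lemma adjoin_gen : adjoin B x x.
Proof.
exists 2, 1, 0; split; first by case: sB.
  exact: span_below0.
by rewrite mul1r addr0 expr1.
Qed.

Lemma adjoinB a b : adjoin B x a -> adjoin B x b -> adjoin B x (a - b).
Proof.
move=> [m Pa] [n Pb]; exists (maxn m n); apply: span_belowB.
  exact: span_belowW (leq_maxl _ _) _ Pa.
exact: span_belowW (leq_maxr _ _) _ Pb.
Qed.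

Lemma adjoinM a b : adjoin B x a -> adjoin B x b -> adjoin B x (a * b).
Proof.
have adjoinMX n c : adjoin B x c -> adjoin B x (x ^+ n * c).
  elim: n => [|n IH]; first by rewrite mul1r.
  by move=> /IH[m Pc]; exists m.+1; rewrite exprS -mulrA; exact: span_belowX.
have adjoin0 : adjoin B x 0 by exists 0%N.
have adjoinD c d : adjoin B x c -> adjoin B x d -> adjoin B x (c + d).
  move=> Pc Pd; rewrite -[d]opprK; apply: adjoinB => //.
  by rewrite -sub0r; exact: adjoinB.
move=> [m]; elim: m a => [|m IH] a /=; first by move=> -> _; rewrite mul0r.
move=> [a1 [a2 [Ba Pa ->]]] Pb; rewrite mulrDl; apply: adjoinD; last exact: IH.
have [n Pxb] := adjoinMX m b Pb.
by exists n; rewrite -mulrA; exact: span_belowM.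
Qed.

Lemma subring_adjoin : subring (adjoin B x).
Proof.
split; [|exact: adjoinB|exact: adjoinM].
by apply: adjoin_base; case: sB.
Qed.

Lemma ideal_lead_coefs m I :
  ideal_of (adjoin B x) I -> ideal_of B (lead_coefs B x m I).
Proof.
move=> [_ I0 ID IM]; split=> [b []//||a b [Ba [c Pc Ic]] [Bb [d Pd Id]]|].
- split; first exact: subring0.
  by exists 0; [exact: span_below0 | rewrite mul0r addr0].
- split; first exact: subringD.
  exists (c + d); first exact: span_belowD.
  by rewrite mulrDl addrACA; exact: ID.
- move=> a b Ba [Bb [c Pc Ic]]; split; first by case: sB => _ _; apply.
  exists (a * c); first exact: span_belowM.
  by rewrite -mulrA -mulrDr; apply: IM => //; exact: adjoin_base.
Qed.

Lemma lead_coefsS m I : ideal_of (adjoin B x) I ->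
  lead_coefs B x m I `<=` lead_coefs B x m.+1 I.
Proof.
move=> [_ _ _ IM] b [Bb [c Pc Ic]]; split=> //; exists (x * c).
  exact: span_belowX.
by rewrite exprS mulrCA -mulrDr; apply: IM => //; exact: adjoin_gen.
Qed.

Lemma lead_coefs_sub m I J : I `<=` J ->
  lead_coefs B x m I `<=` lead_coefs B x m J.
Proof. by move=> IJ b [Bb [c Pc /IJ Jc]]; split=> //; exists c. Qed.

(** Induction on the degree of an expression for an element of [J]: subtracting an element of [I]
    with the same leading term leaves an element of [J] of lower degree. *)
Lemma sub_lead_coefs I J :
  ideal_of (adjoin B x) I -> ideal_of (adjoin B x) J -> I `<=` J ->
  (forall m, lead_coefs B x m J `<=` lead_coefs B x m I) -> J `<=` I.
Proof.
move=> [_ I0 ID IM] [JA _ JD JM] IJ leadJI u Ju.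
have A1 : adjoin B x (-1).
  by apply: adjoin_base; apply: subringN => //; case: sB.
have [m] := JA u Ju; elim: m u Ju => [|m IH] u Ju; first by move=> ->.
move=> [b [c [Bb Pc uE]]].
have [_ [c' Pc' Ic']] : lead_coefs B x m I b.
  by apply: leadJI; split=> //; exists c => //; rewrite -uE.
rewrite -[u](subrK (b * x ^+ m + c')); apply: ID => //; apply: IH.
  by apply: JD => //; rewrite -mulN1r; apply: JM => //; exact: IJ.
rewrite uE opprD addrACA subrr add0r; exact: span_belowB.
Qed.

(** The ideals [L m n] increase in both indices. The diagonal stops at some [N], which settles all
    degrees from [N] on; each of the finitely many degrees below [N] has its own bound [h m]. *)
Lemma noetherian_adjoin : noetherian B -> noetherian (adjoin B x).
Proof.
move=> noethB I idI incI.
have incI' := nondecreasing_sub incI.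
pose L m n := lead_coefs B x m (I n).
have idL m n : ideal_of B (L m n) by exact: ideal_lead_coefs.
have LS m n : L m n `<=` L m.+1 n by exact: lead_coefsS.
have LI m n n' : (n <= n')%N -> L m n `<=` L m n'.
  by move=> /incI'; exact: lead_coefs_sub.
have LW m m' n : (m <= m')%N -> L m n `<=` L m' n.
  exact: (nondecreasing_sub (fun i => LS i n)).
have [N diagN] := noethB (fun n => L n n) (fun n => idL n n)
  (fun n => subset_trans (LS n n) (LI n.+1 n n.+1 (leqnSn n))).
have /choice[h hP] m := noethB (L m) (idL m) (fun n => LI m n n.+1 (leqnSn n)).
exists (maxn N (\max_(m < N) h m)) => n; set K := maxn _ _ => Kn.
apply: sub_lead_coefs; [exact: idI|exact: idI|exact: incI'|move=> m].
have [mN|Nm] := ltnP m N.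
  have hK : (h m <= K)%N.
    by rewrite leq_max (leq_bigmax (Ordinal mN)) orbT.
  apply: subset_trans (LI m _ _ hK); apply: hP; exact: leq_trans Kn.
have NK : (N <= K)%N by exact: leq_maxl.
pose M := maxn m n.
apply: (@subset_trans _ (L M M)).
  exact: subset_trans (LW _ M _ (leq_maxl _ _)) (LI _ _ _ (leq_maxr _ _)).
apply: (subset_trans (diagN _ (leq_trans Nm (leq_maxl _ _)))).
exact: subset_trans (LI _ _ _ NK) (LW _ _ _ Nm).
Qed.

End Adjoin.

(** An ideal with a nonzero element [a = c s] contains every [b = c t], since [b = c (t / s) * a];
    so a chain can grow only once, from zero. *)
Lemma noetherian_field (k : fieldType) (c : {rmorphism k -> A}) :
  noetherian (range c).
Proof.
move=> I idI incI.
have [[N [a [Na a0]]]|I0] := pselect (exists N a, I N a /\ a <> 0).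
  exists N => n _ b Ib; have [IC _ _ IM] := idI N.
  have [s _ sa] := IC a Na; have [InC _ _ _] := idI n.
  have [t _ tb] := InC b Ib.
  have s0 : s != 0.
    by apply: contra_notN a0 => /eqP s0; rewrite -sa s0 rmorph0.
  have -> : b = c (t / s) * a by rewrite -sa -rmorphM divfK // tb.
  by apply: IM => //; exists (t / s).
exists 0%N => n _ b Ib; have [_ z _ _] := idI 0%N.
have [-> //|b0] := pselect (b = 0); by case: I0; exists n, b.
Qed.

Lemma subring_range (k : fieldType) (c : {rmorphism k -> A}) :
  subring (range c).
Proof.
split; first by exists 1 => //; rewrite rmorph1.
  by move=> _ _ [s _ <-] [t _ <-]; exists (s - t) => //; rewrite rmorphB.
by move=> _ _ [s _ <-] [t _ <-]; exists (s * t) => //; rewrite rmorphM.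
Qed.

Lemma noetherian_fingen (k : fieldType) (c : {rmorphism k -> A}) (s : seq A) :
  exists B, [/\ subring B, noetherian B, range c `<=` B &
    forall a, a \in s -> B a].
Proof.
elim: s => [|a s [B [sB nB cB sBs]]].
  exists (range c); split=> //; [exact: subring_range|exact: noetherian_field].
exists (adjoin B a); split; [exact: subring_adjoin|exact: noetherian_adjoin| |].
  by move=> b /cB; exact: adjoin_base.
move=> b; rewrite inE => /orP[/eqP->|/sBs]; first exact: adjoin_gen.
exact: adjoin_base.
Qed.

End HilbertBasis.

(** * Noetherian topology of schemes of finite type *)

Section NoetherianScheme.
Context {k : fieldType} {X : scheme k}.

Lemma noetherian_sections (U : opens X) :
  finitely_generated U -> noetherian [set: sections U].
Proof.
move=> [n [a agen]].
have [B [[B1 BB BM] nB cB aB]] :=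
  noetherian_fingen (const U) [seq a i | i : 'I_n].
suff -> : [set: sections U] = B by [].
apply/seteqP; split=> // s _.
have := agen [pred s | `[< B s >]]; rewrite /GRing.subring_closed.
move=> /(_ _ _ _ s)/asboolP; apply.
- split; first exact/asboolP.
    by move=> u v /asboolP Bu /asboolP Bv; apply/asboolP; exact: BB.
  by move=> u v /asboolP Bu /asboolP Bv; apply/asboolP; exact: BM.
- by move=> t; apply/asboolP; apply: cB; exists t.
- by move=> i; apply/asboolP; apply: aB; exact/map_f/mem_enum.
Qed.

(** On an affine [U] this is the ideal of the trace of [Z]: the intersection of the primes attached
    to the points of [Z] in [U]. *)
Definition vanishing (U : opens X) (Z : set X) : set (sections U) :=
  [set s | forall x, oset U x -> Z x -> ~ unit_at s x].
Arguments vanishing : clear implicits.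

Lemma ideal_vanishing (U : opens X) Z :
  affine U -> ideal_of setT (vanishing U Z).
Proof.
move=> [primeU _ _ _].
have primex x : oset U x -> prime_ideal [set s : sections U | ~ unit_at s x].
  by move=> Ux; apply/primeU; exists x.
split=> // [x Ux _|a b Ia Ib x Ux Zx|a b _ Ib x Ux Zx].
- by have [[]] := primex x Ux.
- by have [_ PD _ _] := primex x Ux; apply: PD; [exact: Ia | exact: Ib].
- by have [_ _ PM _] := primex x Ux; apply: PM; exact: Ib.
Qed.

(** A point of [Z'] in [U] outside [Z] would have a principal neighbourhood missing [Z]; its section
    vanishes on [Z] but not at the point. *)
Lemma vanishing_sub (U : opens X) (Z Z' : set X) :
  affine U -> closed Z -> vanishing U Z `<=` vanishing U Z' ->
  Z' `&` U `<=` Z.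
Proof.
move=> [_ _ basisU _] cZ ZZ' x [Z'x Ux]; apply: contrapT => NZx.
pose W : opens X := Opens (openI (oset_open U) (closed_openC cZ)).
have [|//|s sx sW] := basisU W x; first by move=> y [].
by apply: (ZZ' s _ x Ux Z'x sx) => y _ Zy /sW[].
Qed.

(** On each of the finitely many affine charts the vanishing ideals form an increasing chain; [N] is
    the largest of the stages where these stop. *)
Lemma closed_chain_stationary : finite_type X ->
  forall Z : nat -> set X, (forall n, closed (Z n)) ->
  (forall n, Z n.+1 `<=` Z n) -> exists N, Z N `<=` Z N.+1.
Proof.
move=> [m [U [covU affU]]] Z cZ decZ.
have /choice[h hP] i : exists N, forall n, (N <= n)%N ->
    vanishing (U i) (Z n) `<=` vanishing (U i) (Z N).
  have [aU fgU] := affU i; apply: noetherian_sections => // n.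
    exact: ideal_vanishing.
  by move=> s Is x Ux /decZ; exact: Is.
exists (\max_i h i) => x Zx; have [i Ux] := covU x.
have [aU _] := affU i.
set N := \max_i h i in Zx *; have hN : (h i <= N)%N by exact: leq_bigmax.
apply: (vanishing_sub aU (cZ _)) (conj Zx Ux) => s /(hP i _ (leqW hN)) Is.
move=> y Uy Zy; apply: Is => //; rewrite -(subnK hN) in Zy.
by elim: (N - h i)%N Zy => //= j IH /decZ.
Qed.

(** Without a minimal set, choice would give a strictly decreasing sequence of closed sets
    satisfying [P]. *)
Lemma minimal_closed (P : set X -> Prop) (V : set X) :
  finite_type X -> closed V -> P V ->
  exists Z, [/\ closed Z, P Z, Z `<=` V &
    forall Z', closed Z' -> P Z' -> Z' `<=` Z -> Z' = Z].
Proof.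
move=> ftX cV PV; apply: contrapT => nomin.
pose T := {Z : set X | [/\ closed Z, P Z & Z `<=` V]}.
have /choice[h hP] (Z : T) : exists Z' : T, sval Z' `<` sval Z.
  case: Z => Z [cZ PZ ZV] /=; apply: contrapT => noZ'; apply: nomin.
  exists Z; split=> // Z' cZ' PZ' Z'Z; apply: contrapT => neq; apply: noZ'.
  have cP : [/\ closed Z', P Z' & Z' `<=` V].
    by split=> //; exact: subset_trans ZV.
  by exists (exist _ Z' cP) => /=; rewrite properEneq; split=> //; exact/eqP.
have V0 : [/\ closed V, P V & V `<=` V] by split.
pose Z n := iter n h (exist _ V V0).
have [||N] := closed_chain_stationary ftX (Z := fun n => sval (Z n)).
- by move=> n; have [] := svalP (Z n).
- by move=> n; have [] := hP (Z n).
- by have [_] := hP (Z N).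
Qed.

End NoetherianScheme.

(** * Banach density *)

Section Density.
Implicit Types (S T : set nat) (a l : nat).

Definition hits S a l : nat := count (fun i => `[< S i >]) (iota a l).

(** Banach density zero without division: the proportion of [S] in any window of length at least [L]
    is at most 1/K, wherever the window starts. *)
Definition uniformly_sparse S : Prop :=
  forall K : nat, exists L : nat, forall a l,
    (L <= l)%N -> (K * hits S a l <= l)%N.

Lemma hits_sub S T a l : S `<=` T -> (hits S a l <= hits T a l)%N.
Proof. by move=> ST; apply: sub_count => i /asboolP/ST/asboolP. Qed.

Lemma uniformly_sparse_sub S T :
  S `<=` T -> uniformly_sparse T -> uniformly_sparse S.
Proof.
move=> ST spT K; have [L hL] := spT K; exists L => a l /(hL a).
by apply: leq_trans; rewrite leq_mul2l hits_sub ?orbT.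
Qed.

Lemma uniformly_sparse0 : uniformly_sparse set0.
Proof.
move=> K; exists 0%N => a l _; rewrite /hits.
by rewrite (eq_count (a2 := pred0)) ?count_pred0 ?muln0// => i; apply/asboolP.
Qed.

Lemma hitsU S T a l : (hits (S `|` T) a l <= hits S a l + hits T a l)%N.
Proof.
rewrite /hits -count_predUI; apply: leq_trans (leq_addr _ _).
apply: sub_count => i /asboolP[Si|Ti]; apply/orP; [left|right];
  exact/asboolP.
Qed.

Lemma uniformly_sparseU S T :
  uniformly_sparse S -> uniformly_sparse T -> uniformly_sparse (S `|` T).
Proof.
move=> spS spT K; have [L hL] := spS (K * 2)%N; have [L' hL'] := spT (K * 2)%N.
exists (maxn L L') => a l; rewrite geq_max => /andP[/(hL a) h1 /(hL' a) h2].
have := hitsU S T a l; nia.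
Qed.

(** Each element of [T] clears the [M] integers after it, so it uses up a block of length [M.+1];
    the extra [M] pays for a last block cut off by the end of the window. *)
Lemma hits_spread T M a l :
  (forall n d, T n -> (0 < d <= M)%N -> ~ T (n + d)%N) ->
  (M.+1 * hits T a l <= l + M)%N.
Proof.
move=> spread; elim/ltn_ind: l a => -[|l] IH a; first by rewrite muln0.
have [Ta|NTa] := pselect (T a); last first.
  rewrite /hits /= asboolF // add0n.
  by apply: leq_trans (IH l _ _) _ => //; lia.
have gap i : (a < i <= a + M)%N -> `[< T i >] = false.
  move=> ai; apply/asboolP; have -> : i = (a + (i - a))%N by lia.
  by apply: spread => //; lia.
(* [j] is the part of the cleared block after [a] that fits in the window. *)
pose j := minn M l.
have -> : hits T a l.+1 = (hits T (a.+1 + j) (l - j)).+1.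
  rewrite /hits /= asboolT // add1n; congr _.+1.
  have -> : l = (j + (l - j))%N by rewrite subnKC // geq_minr.
  rewrite iotaD count_cat addKn (@eq_in_count _ _ pred0) ?count_pred0//.
  by move=> i; rewrite mem_iota /j => ij; apply: gap; lia.
have [lM|Ml] := leqP l M; first by rewrite (_ : l - j = 0)%N ?muln1 /j; lia.
have := IH (l - j)%N _ (a.+1 + j)%N; rewrite /j; lia.
Qed.

(* The elements of S with no other element of S among the next M integers have
   density at most 1 / (M + 1); the remaining ones lie in one of the M sets of
   n such that n and n + d are in S, 1 <= d <= M. *)
Lemma recurrence S : ~ uniformly_sparse S ->
  exists2 d, (0 < d)%N & ~ uniformly_sparse [set n | S n /\ S (n + d)%N].
Proof.
move=> nspS; apply: contrapT => nod; apply: nspS.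
pose Q d := [set n | S n /\ S (n + d)%N].
have spQ d : (0 < d)%N -> uniformly_sparse (Q d).
  by move=> d0; apply: contrapT => nsp; apply: nod; exists d.
have spUQ M : uniformly_sparse [set n | exists2 d, (0 < d <= M)%N & Q d n].
  elim: M => [|M IH].
    by apply: uniformly_sparse_sub uniformly_sparse0 => n [d]; lia.
  apply: uniformly_sparse_sub (uniformly_sparseU IH (spQ M.+1 isT)).
  move=> n [d dM Qd].
  have [dM'|dM'] := leqP d M; first by left; exists d => //; lia.
  by right; have <- : d = M.+1 by lia.
(* For windows of length l at least [M], [hits_spread] bounds 4K times the hits of [T] by 2l. So 2K
   times the hits is at most l both for [T] and for the remaining elements, and the two bounds add
   up. *)
move=> K; pose M := (4 * K)%N.
pose T := [set n | S n /\ forall d, (0 < d <= M)%N -> ~ S (n + d)%N].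
have [L hL] := spUQ M (2 * K)%N.
exists (maxn L M) => a l; rewrite geq_max => /andP[/(hL a) hl Ml].
have ST : S `<=` T `|` [set n | exists2 d, (0 < d <= M)%N & Q d n].
  move=> n Sn.
  have [[d dM Sd]|nd] := pselect (exists2 d, (0 < d <= M)%N & S (n + d)%N).
    by right; exists d.
  by left; split=> // d dM Sd; apply: nd; exists d.
have hT : (M.+1 * hits T a l <= l + M)%N.
  by apply: hits_spread => n d [_ h] /h Nd [].
have := leq_trans (hits_sub a l ST) (hitsU _ _ _ _).
move: hT hl Ml; rewrite /M; nia.
Qed.

Lemma cardinal_hits S a b : (a <= b)%N ->
  cardinal (S `&` [set m | (a <= m <= b)%N]) = hits S a (b - a).+1.
Proof.
move=> ab; rewrite /cardinal /hits.
set s := [seq i <- iota a (b - a).+1 | `[< S i >]].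
have -> : S `&` [set m | (a <= m <= b)%N] = [set` [fset i in s]%fset].
  apply/seteqP; split=> i /=; rewrite !inE /= mem_filter mem_iota.
    by move=> [Si ai]; apply/andP; split; [exact/asboolP | lia].
  by move=> /andP[/asboolP Si ai]; split=> //; lia.
rewrite set_fsetK card_fseq undup_id ?size_filter//.
by rewrite filter_uniq // iota_uniq.
Qed.

Lemma hitsT a l : hits setT a l = l.
Proof.
rewrite /hits (eq_count (a2 := predT)) ?count_predT ?size_iota// => i.
by rewrite asboolT.
Qed.

Lemma uniformly_sparse_density (R : realType) S :
  uniformly_sparse S -> banach_density_zero R S.
Proof.
move=> spS I intI /cvgnyPge cardI; apply/cvgr0Pnorm_le => e e0.
(* As e K > 1, a bound of K times the hits by the length makes the hits at most e times the
   length. *)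
pose K := Num.bound e^-1.
have eK : e^-1 < K%:R by apply: archi_boundP; rewrite invr_ge0 ltW.
have [L hL] := spS K.
near=> n.
have [a [b [ab In]]] := intI n.
have cI : cardinal (I n) = (b - a).+1.
  by rewrite In -[X in cardinal X]setTI cardinal_hits // hitsT.
rewrite cI In cardinal_hits //.
have Ll : (L <= (b - a).+1)%N by rewrite -cI; near: n; exact: cardI.
have := hL a _ Ll; rewrite -(ler_nat R) natrM => hK.
rewrite ger0_norm ?divr_ge0// ler_pdivrMr ?ltr0n//.
apply: le_trans (_ : e * (K%:R * (hits S a (b - a).+1)%:R) <= _); last first.
  by rewrite ler_pM2l.
rewrite mulrA ler_peMl //.
by rewrite -ler_pdivrMl // mulr1 ltW.
Unshelve. all: by end_near.
Qed.

End Density.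

(** * Orbits *)

Section Irreducible.
Context {T : topologicalType}.
Implicit Types A B V : set T.

Lemma dense_sub A B : A `<=` B -> dense A -> dense B.
Proof. by move=> AB dA N N0 oN; have [x [Nx /AB]] := dA N N0 oN; exists x. Qed.

Lemma closed_dense V : closed V -> dense V -> V = setT.
Proof.
move=> cV dV; apply/seteqP; split=> // x _; apply: contrapT => NVx.
by have [|y []] := dV _ _ (closed_openC cV); first by exists x.
Qed.

(** Nonempty open sets [N] missing [A] and [M] missing [B] would be disjoint, the union being dense;
    their complements would then be proper closed sets covering [T]. *)
Lemma irreducible_denseU A B :
  irreducible T -> dense (A `|` B) -> dense A \/ dense B.
Proof.
move=> [_ irrT] dAB; apply: contrapT => /not_orP[/denseNE + /denseNE].
move=> [N [[x [oN Nx]] NA]] [M [[y [oM My]] MB]].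
have [|||h|h] := irrT (~` N) (~` M); [exact: open_closedC..| | |].
- rewrite -setCI -setC0; congr (~` _); apply: contrapT => /eqP/set0P NM0.
  have [z [[Nz Mz] [Az|Bz]]] := dAB _ NM0 (openI oN oM).
    by have : (N `&` A) z by []; rewrite NA.
  by have : (M `&` B) z by []; rewrite MB.
- by have : (~` N) x by rewrite h.
- by have : (~` M) y by rewrite h.
Qed.

Lemma irreducible_dense_bigcup (d : nat) (A : nat -> set T) :
  irreducible T -> dense (\bigcup_(i < d) A i) ->
  exists2 i, (i < d)%N & dense (A i).
Proof.
move=> irrT; elim: d => [|d IH].
  by rewrite bigcup_mkord big_ord0 => /(_ _ irrT.1 openT)[x []].
rewrite bigcup_mkord big_ord_recr -bigcup_mkord /=.
move=> /(irreducible_denseU irrT)[/IH[i id di]|dd].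
  by exists i => //; exact: ltnW.
by exists d.
Qed.

End Irreducible.

Section Orbit.
Context {k : fieldType} {X : scheme k} (f : rational_map X X) (x : X).
Context (sepX : separated_scheme X) (domf : dominant f).
Context (orb : orbit_well_defined f x).

Local Notation F := (rat_app f).

Definition visits (V : set X) : set nat := [set n | V (iter n F x)].

(** Each application of the dominant map keeps the set of orbit points dense. *)
Lemma dense_orbit_shift (S : set nat) j :
  dense [set iter n F x | n in S] -> dense [set iter (j + n) F x | n in S].
Proof.
elim: j => [//|j IH] /IH dS.
apply: (dense_sub _ (dense_image_rat_app sepX domf _ dS)).
  by move=> _ [_ [n Sn <-] <-]; exists n.
by move=> _ [n Sn <-]; exact: orb.
Qed.

Lemma minimal_visits (Z : set X) :
  closed Z -> ~ uniformly_sparse (visits Z) ->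
  (forall Z', closed Z' -> ~ uniformly_sparse (visits Z') -> Z' `<=` Z ->
    Z' = Z) ->
  exists2 d, (0 < d)%N & forall n, visits Z n -> visits Z (n + d)%N.
Proof.
move=> cZ nspZ minZ; have [d d0 nspd] := recurrence nspZ; exists d => // n Zn.
pose S := [set m | visits Z m /\ visits Z (m + d)%N].
pose E := [set iter m F x | m in S].
(* The closure lies in [Z] and is visited at all times in [S], which are not sparse, so minimality
   applies. *)
have EZ : closure E = Z.
  apply: minZ; first exact: closed_closure.
    apply: contra_not nspd; apply: uniformly_sparse_sub => m Sm.
    by apply: subset_closure; exists m.
  have /closure_id-> := cZ.
  by apply: closure_subset => _ [m [Zm _] <-].
(* If the point at time [n + d] were outside [Z], a neighbourhood of the point at time [n] would be
   sent outside [Z] by the d-th iterate; but it meets [E], whose points in the orbit return to [Z]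
   after [d] steps. *)
apply: contrapT => NZ.
have orbn i : ~ indeterminacy f (iter i F (iter n F x)).
  by rewrite -iterD; exact: orb.
have [|M [oM Mn MZ]] := iter_rat_app_cont sepX (d := d) orbn (closed_openC cZ).
  by rewrite -iterD addnC.
have : closure E (iter n F x) by rewrite EZ.
case/(_ M (open_nbhs_nbhs (conj oM Mn))) => _ [[m [_ Zmd] <-] /MZ].
by rewrite -iterD addnC.
Qed.

Lemma dense_orbit_visits_sparse (V : set X) :
  irreducible X -> finite_type X -> dense (forward_orbit f x) ->
  closed V -> V <> setT -> uniformly_sparse (visits V).
Proof.
move=> irrX ftX dorb cV VT; apply: contrapT => nspV.
have [Z [cZ nspZ ZV minZ]] :=
  minimal_closed (P := fun W => ~ uniformly_sparse (visits W)) ftX cV nspV.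
have [d d0 Zd] := minimal_visits cZ nspZ minZ.
have [n Zn] : visits Z !=set0.
  by apply/set0P/eqP => Z0; apply: nspZ; rewrite Z0; exact: uniformly_sparse0.
have Znd j : visits Z (n + j * d)%N.
  by elim: j => [|j /Zd]; rewrite ?addn0// -addnA mulSn [(d + _)%N]addnC.
(* The orbit from time [n] on is still dense and is split by residues modulo [d] into the sets
   [A i]. *)
pose A i := [set iter m F x | m in [set (n + i + j * d)%N | j in [set: nat]]].
have /(irreducible_dense_bigcup irrX)[i id dAi] : dense (\bigcup_(i < d) A i).
  apply: (dense_sub _ (dense_orbit_shift n dorb)) => _ [m _ <-].
  exists (m %% d)%N; first by rewrite /= ltn_mod.
  exists (n + m)%N => //; exists (m %/ d)%N => //.
  by rewrite {3}(divn_eq m d); lia.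
apply: VT; apply: closed_dense => //; apply: dense_sub ZV _.
(* As [i < d], shifting by [d - i] moves the times of [A i] to [n + j.+1 * d], where the orbit is in
   [Z]. *)
apply: dense_sub (dense_orbit_shift (d - i) dAi).
move=> _ [_ [j _ <-] <-]; have -> : (d - i + (n + i + j * d) = n + j.+1 * d)%N.
  by rewrite mulSn; lia.
exact: Znd.
Qed.

End Orbit.

Theorem theorem1p16 (R : realType) (k : closedFieldType) (X : variety k)
    (f : rational_map X X) (x : X) (V : set X) :
  dominant f ->
  rational_point x ->
  orbit_well_defined f x ->
  dense (forward_orbit f x) ->
  closed V -> V <> setT ->
  banach_density_zero R [set n | V (iter n (rat_app f) x)].
Proof.
move=> domf _ orb dorb cV VT; apply: uniformly_sparse_density.
apply: dense_orbit_visits_sparse => //.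
- exact: var_separated.
- exact: var_irreducible.
- exact: var_finite_type.
Qed.
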